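(* Let $t_1,\dots,t_N\in[0,1]$. If all data points are Dirac measures, i.e. $\mu_{t_i}(\mathbf{y}_i)=\delta_{\mathbf{v}_i}(\mathbf{y}_i)$, $i=1,\dots,N$, where $\mathbf{v}_i\in\mathbf{R}^d$, then the multi-marginal formulation $$\inf_{\gamma}\int_{\mathbf{R}^{(N+2)d}}\sum_{i=1}^{N}\frac1N\big\|(1-t_i)\mathbf{x}_0+t_i\mathbf{x}_1-\mathbf{y}_i\big\|^2\,d\gamma\quad\text{subject to}\quad(\mathbf{y}_i)_\#\gamma=\mu_{t_i},\ \ i=1,\dots,N,$$ where $\gamma(\mathbf{x}_0,\mathbf{x}_1,\mathbf{y}_1,\dots,\mathbf{y}_N)\in\mathcal{P}_2(\mathbf{R}^{(N+2)d})$, reduces to Euclidean regression.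
   Context: $\mathcal{P}_2(\mathbf{R}^n)$ is the set of Borel probability measures on $\mathbf{R}^n$ with finite second moments; $\delta_{\mathbf{v}}$ is the Dirac measure at $\mathbf{v}$; $\|\cdot\|$ is the Euclidean norm. Points of $\mathbf{R}^{(N+2)d}=(\mathbf{R}^d)^{N+2}$ are written $(\mathbf{x}_0,\mathbf{x}_1,\mathbf{y}_1,\dots,\mathbf{y}_N)$, and $(\mathbf{y}_i)_\#\gamma$ denotes the push-forward of $\gamma$ under the coordinate projection onto $\mathbf{y}_i$, i.e. its $\mathbf{y}_i$-marginal. Euclidean regression means ordinary linear least squares in $\mathbf{R}^d$: given the dataset $\{(t_i,\mathbf{v}_i)\}_{i=1}^N$, one seeks a linear model $\mathbf{x}=\mathbf{x}_0+t\mathbf{v}+\boldsymbol{\epsilon}$ with initial point $\mathbf{x}_0\in\mathbf{R}^d$, tangent vector $\mathbf{v}\in\mathbf{R}^d$ and $\mathbf{R}^d$-valued measurement error $\boldsymbol{\epsilon}$, choosing $\mathbf{x}_0$ and $\mathbf{v}$ by least squares. *)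

(* Defs.v *)
From HB Require Import structures.
From mathcomp Require Import all_boot all_order all_algebra.
From mathcomp Require Import all_classical all_reals all_analysis.

Set Implicit Arguments.
Unset Strict Implicit.
Unset Printing Implicit Defensive.

Import Order.TTheory GRing.Theory Num.Theory.
Import numFieldNormedType.Exports.

Local Open Scope classical_set_scope.
Local Open Scope ring_scope.

(* R^(m n), as m x n matrices, with its Borel sigma-algebra; R^n is the case
   m = 1.  The library puts the product topology on matrices, which is the
   usual topology. *)
Definition borelMx (R : realType) (m n : nat) :=
  g_sigma_algebraType (@open 'M[R]_(m, n)).

(* The library norm `|A| on matrices is the sup norm, hence this one. *)
Definition enorm (R : realType) (m n : nat) (A : 'M[R]_(m, n)) : R :=
  Num.sqrt (\sum_(i < m) \sum_(j < n) A i j ^+ 2).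

Definition finite_second_moment (R : realType) (m n : nat)
    (gamma : probability (borelMx R m n) R) : Prop :=
  (\int[gamma]_z (enorm (z : 'M[R]_(m, n)) ^+ 2)%:E < +oo)%E.

(* A point (x_0, x_1, y_1, ..., y_N) of (R^d)^(N+2) is the matrix with these
   rows, in this order. *)
Section MultiMarginal.
Context (R : realType) (N d : nat).
Implicit Types (t : 'I_N -> R) (z : 'M[R]_(2 + N, d)).

Definition x0_of z : 'rV[R]_d := row (lshift N 0) z.
Definition x1_of z : 'rV[R]_d := row (lshift N 1) z.
Definition y_of (i : 'I_N) z : 'rV[R]_d := row (rshift 2 i) z.

Definition point_of (x0 x1 : 'rV[R]_d) (y : 'I_N -> 'rV[R]_d) :
    'M[R]_(2 + N, d) :=
  col_mx (col_mx x0 x1) (\matrix_(i < N) y i).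

Definition mm_cost t z : R :=
  \sum_(i < N) N%:R^-1 *
    enorm ((1 - t i) *: x0_of z + t i *: x1_of z - y_of i z) ^+ 2.

Definition mm_objective t (gamma : probability (borelMx R (2 + N) d) R) :
    \bar R :=
  (\int[gamma]_z (mm_cost t z)%:E)%E.

(* Measures are compared on Borel sets only: their values on other sets carry
   no meaning. *)
Definition mm_feasible (mu : 'I_N -> probability (borelMx R 1 d) R) :
    set (probability (borelMx R (2 + N) d) R) :=
  [set gamma | finite_second_moment gamma /\
    forall (i : 'I_N) (A : set (borelMx R 1 d)), measurable A ->
      pushforward gamma
        (y_of i : borelMx R (2 + N) d -> borelMx R 1 d) A = mu i A].

Definition mm_value t (mu : 'I_N -> probability (borelMx R 1 d) R) : \bar R :=
  ereal_inf (mm_objective t @` mm_feasible mu).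

Definition mm_optimal t (mu : 'I_N -> probability (borelMx R 1 d) R)
    (gamma : probability (borelMx R (2 + N) d) R) : Prop :=
  mm_feasible mu gamma /\
  forall gamma', mm_feasible mu gamma' ->
    (mm_objective t gamma <= mm_objective t gamma')%E.

(* Residual sum of squares of the linear model x = x0 + t v on the dataset
   (t_i, y_i). *)
Definition rss t (y : 'I_N -> 'rV[R]_d) (x0 v : 'rV[R]_d) : R :=
  \sum_(i < N) enorm (y i - (x0 + t i *: v)) ^+ 2.

Definition least_squares t (y : 'I_N -> 'rV[R]_d) (x0 v : 'rV[R]_d) : Prop :=
  forall x0' v' : 'rV[R]_d, rss t y x0 v <= rss t y x0' v'.

End MultiMarginal.

(* Main.v *)
Require Import Defs.
From HB Require Import structures.
From mathcomp Require Import all_boot all_order all_algebra.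
From mathcomp Require Import all_classical all_reals all_analysis.
From mathcomp Require Import measurable_realfun ring.

Set Implicit Arguments.
Unset Strict Implicit.
Unset Printing Implicit Defensive.

Import Order.TTheory GRing.Theory Num.Theory.
Import numFieldNormedType.Exports.
Local Open Scope classical_set_scope.
Local Open Scope ring_scope.

(** Why the theorem holds.  A coupling gamma whose y_i-marginal is the Dirac
    mass at v_i is concentrated on the set of points z with y_i(z) = v_i for
    all i ([feasible_ae_data]).  There the integrand mm_cost t z is 1/N times
    the residual sum of squares of the line through x_0(z) with tangent
    x_1(z) - x_0(z) ([mm_cost_rss]); write lsq_min for the infimum of these
    values over all lines.  Hence the objective of a feasible gamma is the mean
    of a function that is almost surely at least lsq_min, so it is at least
    lsq_min ([objective_lb]).  Conversely each line (x_0, w) gives a feasible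
    Dirac coupling, whose objective is exactly 1/N times the residual sum of
    squares of that line ([objective_dirac]).  So the two infima agree.

    Since the value of the problem is the finite number lsq_min, gamma is
    optimal iff its objective equals lsq_min.  A nonnegative function bounded below
    almost surely by a constant has that constant as its mean iff it equals it almost
    surely ([expectation_eq_lb]); thus gamma is optimal iff almost every z
    attains lsq_min, which says that its line is a least squares fit.  For a
    Dirac coupling the mean is a single value of the cost. *)

(** * Almost sure lower bounds and expectations *)

Section ExpectationLowerBound.
Context (d : measure_display) (T : measurableType d) (R : realType).
Context (P : probability T R) (f : T -> R) (m : R).
Context (mf : measurable_fun setT f) (f0 : forall x, 0 <= f x).

Let integral_const : (\int[P]_x m%:E = m%:E)%E.
Proof.
by apply: etrans (integral_cst P measurableT m%:E) _; rewrite /= probability_setT mule1.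
Qed.

Lemma expectation_ge_lb : 0 <= m -> {ae P, forall x, m <= f x} ->
  (m%:E <= \int[P]_x (f x)%:E)%E.
Proof.
move=> m0 mlef.
rewrite -[leLHS]integral_const; apply: ae_ge0_le_integral => //.
- by move=> x _; rewrite lee_fin.
- exact/measurable_EFinP.
- by apply: filterS mlef => x mx _; rewrite lee_fin.
Qed.

(** The nonnegative variable f - m has mean zero iff it vanishes almost
    surely. *)
Lemma expectation_eq_lb : {ae P, forall x, m <= f x} ->
  (\int[P]_x (f x)%:E = m%:E)%E <-> {ae P, forall x, f x = m}.
Proof.
move=> mlef; split=> [intf | fm]; last first.
  rewrite (ae_eq_integral (cst m%:E))//.
  - exact/measurable_EFinP.
  - by apply: filterS fm => x fx _ /=; rewrite fx.
have mEf : measurable_fun setT (EFin \o f) by exact/measurable_EFinP.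
have fint : P.-integrable setT (EFin \o f).
  apply/integrableP; split => //.
  under eq_integral do rewrite /= ger0_norm//.
  by rewrite intf ltry.
have mint : P.-integrable setT (EFin \o cst m).
  exact: finite_measure_integrable_cst.
have mB : measurable_fun setT (fun x => (f x - m)%:E).
  by apply/measurable_EFinP; apply: measurable_funB.
have /(ae_eq_integral_abs P measurableT mB) :
    (\int[P]_x `|(f x - m)%:E| = 0)%E.
  rewrite (ae_eq_integral (fun x => (f x)%:E - (cst m x)%:E)%E)//.
  - rewrite integralB_EFin// intf integral_const subee//.
  - exact: measurableT_comp.
  - by apply: filterS mlef => x mx _ /=; rewrite ger0_norm// subr_ge0.
by apply: filterS => x /(_ I) [] /eqP; rewrite subr_eq0 => /eqP.
Qed.

End ExpectationLowerBound.

(** * Borel measurability on matrix spaces *)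

Lemma enorm_sqr (R : realType) m n (A : 'M[R]_(m, n)) :
  enorm A ^+ 2 = \sum_(i < m) \sum_(j < n) A i j ^+ 2.
Proof.
by rewrite sqr_sqrtr// sumr_ge0// => i _; rewrite sumr_ge0// => j _; exact: sqr_ge0.
Qed.

Lemma enormN (R : realType) m n (A : 'M[R]_(m, n)) : enorm (- A) = enorm A.
Proof.
by congr Num.sqrt; apply: eq_bigr => i _; apply: eq_bigr => j _; rewrite mxE sqrrN.
Qed.

(** Borel sets of the line are generated by open rays, whose preimages under a
    continuous function are open. *)
Lemma measurable_entry (R : realType) m n (i : 'I_m) (j : 'I_n) :
  measurable_fun setT (fun z : borelMx R m n => (z : 'M[R]_(m, n)) i j).
Proof.
apply: (measurability (@RGenOInfty.G R)); first exact: RGenOInfty.measurableE.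
move=> _ [_ [x ->] <-]; rewrite setTI.
apply: sub_sigma_algebra; apply: open_comp => [z _|]; last exact: rray_open.
exact: coord_continuous.
Qed.

Section EntrywiseMeasurable.
Context (d : measure_display) (T : measurableType d) (R : realType) (m n : nat).
Context (F : T -> 'M[R]_(m, n)).
Context (mF : forall i j, measurable_fun setT (fun x => F x i j)).

Lemma measurable_enorm_sqr : measurable_fun setT (fun x => enorm (F x) ^+ 2).
Proof.
under eq_fun do rewrite enorm_sqr.
by apply: measurable_sum => i; apply: measurable_sum => j; exact: measurable_funX.
Qed.

Lemma measurable_fiber (B : 'M[R]_(m, n)) : measurable (F @^-1` [set B]).
Proof.
rewrite (_ : F @^-1` _ =
    \bigcap_(i in setT) \bigcap_(j in setT) (fun x => F x i j) @^-1` [set B i j]).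
  apply: fin_bigcap_measurable => // i _; apply: fin_bigcap_measurable => // j _.
  by rewrite -[_ @^-1` _]setTI; exact: mF.
apply/seteqP; split=> x /= FB; first by move=> i _ j _ /=; rewrite FB.
by apply/matrixP => i j; exact: FB.
Qed.

End EntrywiseMeasurable.

(** * The multi-marginal problem with Dirac data *)

Section DiracData.
Context (R : realType) (N d : nat) (t : 'I_N -> R) (v : 'I_N -> 'rV[R]_d).
Context (N0 : (0 < N)%N).
Implicit Types (x w : 'rV[R]_d) (z : borelMx R (2 + N) d).

Lemma measurable_y i k j : measurable_fun setT (fun z => y_of i z k j).
Proof. by under eq_fun do rewrite mxE; exact: measurable_entry. Qed.

Lemma measurable_mm_cost : measurable_fun setT (fun z => mm_cost t z).
Proof.
apply: measurable_sum => i; apply: measurable_funM => //.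
apply: measurable_enorm_sqr => k j; under eq_fun do rewrite !mxE.
by apply: measurable_funB; [apply: measurable_funD; apply: measurable_funM|];
  rewrite //; exact: measurable_entry.
Qed.

Lemma mm_cost_ge0 z : 0 <= mm_cost t z.
Proof. by apply: sumr_ge0 => i _; rewrite mulr_ge0// ?invr_ge0// sqr_ge0. Qed.

Lemma rss_ge0 x w : 0 <= rss t v x w.
Proof. by apply: sumr_ge0 => i _; exact: sqr_ge0. Qed.

(** The geodesic (1 - t) x_0 + t x_1 is the line x_0 + t (x_1 - x_0). *)
Lemma mm_cost_rss z : (forall i, y_of i z = v i) ->
  mm_cost t z = N%:R^-1 * rss t v (x0_of z) (x1_of z - x0_of z).
Proof.
move=> yv; rewrite mulr_sumr; apply: eq_bigr => i _; congr (_ * _ ^+ 2).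
(* The cost and the residual sum of squares take residuals of opposite sign. *)
rewrite -enormN yv; congr enorm.
by apply/rowP => j; rewrite !mxE; ring.
Qed.

Lemma x0_of_point x x' (y : 'I_N -> 'rV[R]_d) : x0_of (point_of x x' y) = x.
Proof.
rewrite /x0_of /point_of rowKu.
have <- : lshift 1 (0 : 'I_1) = 0 :> 'I_2 by exact/val_inj.
by rewrite (@rowKu _ 1 1) row_id.
Qed.

Lemma x1_of_point x x' (y : 'I_N -> 'rV[R]_d) : x1_of (point_of x x' y) = x'.
Proof.
rewrite /x1_of /point_of rowKu.
have <- : rshift 1 (0 : 'I_1) = 1 :> 'I_2 by exact/val_inj.
by rewrite (@rowKd _ 1 1) row_id.
Qed.

Lemma y_of_point i x x' (y : 'I_N -> 'rV[R]_d) :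
  y_of i (point_of x x' y) = y i.
Proof. by rewrite /y_of rowKd; apply/rowP => j; rewrite !mxE. Qed.

(** The factor 1/N makes this infimum directly comparable with the objective
    of a coupling. *)
Definition lsq_min : R :=
  inf [set N%:R^-1 * rss t v p.1 p.2 | p in [set: 'rV[R]_d * 'rV[R]_d]].

Let lsq_has_lbound :
  has_lbound [set N%:R^-1 * rss t v p.1 p.2 | p in [set: 'rV[R]_d * 'rV[R]_d]].
Proof.
by exists 0 => _ [p _ <-]; rewrite mulr_ge0 ?invr_ge0// rss_ge0.
Qed.

Let lsq_nonempty :
  [set N%:R^-1 * rss t v p.1 p.2 | p in [set: 'rV[R]_d * 'rV[R]_d]] !=set0.
Proof. by exists (N%:R^-1 * rss t v 0 0), (0, 0). Qed.

Lemma lsq_min_ereal :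
  ereal_inf [set (N%:R^-1 * rss t v p.1 p.2)%:E
            | p in [set: 'rV[R]_d * 'rV[R]_d]] = lsq_min%:E.
Proof. by rewrite -ereal_inf_EFin// image_comp. Qed.

Lemma lsq_min_ge0 : 0 <= lsq_min.
Proof.
by apply: lb_le_inf => // _ [p _ <-]; rewrite mulr_ge0 ?invr_ge0// rss_ge0.
Qed.

Lemma lsq_min_le x w : lsq_min <= N%:R^-1 * rss t v x w.
Proof. by apply: (ge_inf lsq_has_lbound); exists (x, w). Qed.

Lemma least_squaresE x w :
  least_squares t v x w <-> N%:R^-1 * rss t v x w = lsq_min.
Proof.
have Ni : 0 < N%:R^-1 :> R by rewrite invr_gt0 ltr0n.
split=> [ls|E x' w'].
  apply/eqP; rewrite eq_le lsq_min_le andbT.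
  by apply: lb_le_inf => // _ [p _ <-]; rewrite ler_pM2l.
by rewrite -(ler_pM2l Ni) E; exact: lsq_min_le.
Qed.

Context (mu : 'I_N -> probability (borelMx R 1 d) R).
Context (hmu : forall (i : 'I_N) (A : set (borelMx R 1 d)), measurable A ->
  mu i A = (\d_(v i : borelMx R 1 d) A)%E).

(** The fiber of y_i over v_i has gamma-mass mu_i {v_i} = 1, so its complement
    is negligible; finitely many negligible sets are then discarded. *)
Lemma feasible_ae_data (gamma : probability (borelMx R (2 + N) d) R) :
  mm_feasible mu gamma -> {ae gamma, forall z, forall i, y_of i z = v i}.
Proof.
move=> [_ marg]; apply: filter_forall => i.
have mv : measurable ([set v i] : set (borelMx R 1 d)).
  exact: (@measurable_fiber _ (borelMx R 1 d) R 1 d id (@measurable_entry R 1 d)).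
have mY : measurable ((y_of i : borelMx R (2 + N) d -> _) @^-1` [set v i]).
  exact: measurable_fiber (measurable_y i) _.
apply/negligibleP; first exact: measurableC.
rewrite [LHS](probability_setC gamma mY) (_ : gamma _ = 1%E) ?subee//.
have := marg i _ mv; rewrite hmu// /pushforward => ->.
by rewrite diracE mem_set.
Qed.

Lemma feasible_ae_lb (gamma : probability (borelMx R (2 + N) d) R) :
  mm_feasible mu gamma -> {ae gamma, forall z, lsq_min <= mm_cost t z}.
Proof.
move=> /feasible_ae_data; apply: filterS => z yv.
by rewrite mm_cost_rss//; exact: lsq_min_le.
Qed.

Lemma objective_lb (gamma : probability (borelMx R (2 + N) d) R) :
  mm_feasible mu gamma -> (lsq_min%:E <= mm_objective t gamma)%E.
Proof.
move=> /feasible_ae_lb; apply: expectation_ge_lb.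
- exact: measurable_mm_cost.
- exact: mm_cost_ge0.
- exact: lsq_min_ge0.
Qed.

Definition dirac_coupling x w : probability (borelMx R (2 + N) d) R :=
  (\d_(point_of x (x + w) v : borelMx R (2 + N) d)).

Lemma feasible_dirac x w : mm_feasible mu (dirac_coupling x w).
Proof.
split=> [|i A mA].
  rewrite /finite_second_moment integral_dirac//=.
    by rewrite diracT mul1e ltry.
  apply/measurable_EFinP.
  exact: (@measurable_enorm_sqr _ (borelMx R (2 + N) d) R _ _ id
    (@measurable_entry R (2 + N) d)).
rewrite hmu// /pushforward /= !diracE; congr ((nat_of_bool _)%:R%:E).
by apply/idP/idP; rewrite !inE /= y_of_point.
Qed.

Lemma objective_dirac x w :
  mm_objective t (dirac_coupling x w) = (N%:R^-1 * rss t v x w)%:E.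
Proof.
rewrite /mm_objective integral_dirac//=; last first.
  by apply/measurable_EFinP; exact: measurable_mm_cost.
rewrite diracT mul1e mm_cost_rss => [|i]; last exact: y_of_point.
by rewrite x0_of_point x1_of_point addrAC subrr add0r.
Qed.

Lemma mm_value_lsq : mm_value t mu = lsq_min%:E.
Proof.
apply/eqP; rewrite eq_le; apply/andP; split.
  rewrite -lsq_min_ereal; apply/ereal_infP => _ [p _ <-].
  apply: ereal_inf_lbound; exists (dirac_coupling p.1 p.2); first exact: feasible_dirac.
  exact: objective_dirac.
by apply/ereal_infP => _ [gamma fg <-]; exact: objective_lb.
Qed.

(** Optimality against every competitor becomes one equation between numbers,
    because the infimum is known and finite; this is the form to which
    [expectation_eq_lb] applies. *)
Lemma mm_optimalE (gamma : probability (borelMx R (2 + N) d) R) :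
  mm_feasible mu gamma ->
  mm_optimal t mu gamma <-> mm_objective t gamma = lsq_min%:E.
Proof.
move=> fg; split=> [[_ opt] | E].
  apply/eqP; rewrite eq_le objective_lb// andbT -mm_value_lsq.
  by apply/ereal_infP => _ [gamma' fg' <-]; exact: opt.
by split=> // gamma' fg'; rewrite E; exact: objective_lb.
Qed.

End DiracData.

Theorem proposition7 (R : realType) (N d : nat) (hN : (0 < N)%N)
    (t : 'I_N -> R) (ht : forall i, 0 <= t i <= 1)
    (v : 'I_N -> 'rV[R]_d)
    (mu : 'I_N -> probability (borelMx R 1 d) R)
    (hmu : forall (i : 'I_N) (A : set (borelMx R 1 d)), measurable A ->
       mu i A = (\d_(v i : borelMx R 1 d) A)%E) :
  [/\ mm_value t mu =
        ereal_inf [set (N%:R^-1 * rss t v p.1 p.2)%:E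
                  | p in [set: 'rV[R]_d * 'rV[R]_d]],
      forall gamma : probability (borelMx R (2 + N) d) R,
        mm_feasible mu gamma ->
        (mm_optimal t mu gamma <->
         {ae gamma, forall z : borelMx R (2 + N) d,
            least_squares t v (x0_of z) (x1_of z - x0_of z)})
    & forall x0 w : 'rV[R]_d,
        mm_optimal t mu
          (\d_(point_of x0 (x0 + w) v : borelMx R (2 + N) d)) <->
        least_squares t v x0 w].
Proof.
split=> [|gamma fg|x0 w].
- by rewrite lsq_min_ereal; exact: mm_value_lsq.
- have data := feasible_ae_data hmu fg.
  apply: iff_trans (mm_optimalE t hmu fg) _.
  apply: iff_trans (expectation_eq_lb (measurable_mm_cost t) (mm_cost_ge0 t)
    (feasible_ae_lb t hmu fg)) _.
  split; apply: filterS2 data => z yv.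
    by rewrite (mm_cost_rss t yv) => E; exact/least_squaresE.
  by rewrite (mm_cost_rss t yv) => ls; exact/least_squaresE.
- apply: iff_trans (mm_optimalE t hmu (feasible_dirac hmu x0 w)) _.
  rewrite objective_dirac; split=> [[E]|ls]; first exact/least_squaresE.
  by congr EFin; exact/least_squaresE.
Qed.
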